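(* Assume $r>0$. For $n\ge0$ and $m\ge1$ define $x^{[m]*}_n:=\inf\{x\ge1:x\ge f^{[m]}_n(x)\}$. Then: (i) $x\mapsto x-f^{[m]}_n(x)$ is strictly increasing on $[1,\infty)$, with every secant slope at least $1-\alpha>0$, and tends to $+\infty$; hence $x^{[m]*}_n\in[1,\infty)$ is well defined and the exercise region is $D^{[m]}_n=\{x\ge1:x\ge f^{[m]}_n(x)\}=[x^{[m]*}_n,\infty)$. (ii) $1=x^{[m]*}_0\le x^{[m]*}_1\le\dots\le x^{[m]*}_N$. (iii) $x^{[m+1]*}_n\le x^{[m]*}_n$, so that $D^{[1]}_n\subseteq D^{[2]}_n\subseteq\dots\subseteq D^{[m]}_n$. (iv) With $\min\emptyset:=\partial$, define $$\sigma^*_m=\min\{\nu\in\{0,\dots,N\}:X_\nu\ge x^{[m]*}_{N-\nu}\},\quad \sigma^*_i=\min\{\nu\in\{0,\dots,N\}:\nu>\sigma^*_{i+1},\ X_\nu\ge x^{[i]*}_{N-\nu}\},\ i=m-1,\dots,1.$$ The finite entries are strictly increasing and unused rights are placed at $\partial$. This rule is optimal (attains the supremum) for $$\sup_{\vec\sigma\in\mathcal T^{[m]}_0}\mathrm E\Big[\sum_{i:\,\sigma_i\le N}\alpha^{\sigma_i}M_{\sigma_i}\Big],$$ and the value of this supremum equals $s_0V^{[m]}_N(m_0/s_0)$.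
   Context: Let $r\ge0$, $\alpha:=(1+r)^{-1}$, and $\lambda>1$ with $\lambda^{-1}<1+r<\lambda$. Put $p:=\frac{(1+r)-\lambda^{-1}}{\lambda-\lambda^{-1}}$, $q:=1-p$ (both in $(0,1)$). Let $N$ be a finite horizon, $S_0=s_0>0$ a constant and $S_\nu=s_0\lambda^{\varepsilon_1+\dots+\varepsilon_\nu}$ ($0\le\nu\le N$), where under $\mathrm P$ the $\varepsilon_\nu$ are i.i.d. with $\mathrm P(\varepsilon_\nu=1)=p$, $\mathrm P(\varepsilon_\nu=-1)=q$; $(\mathcal F_\nu)_{\nu=0}^N$ is the natural filtration of $S$. Let $m_0\ge s_0$, $M_\nu:=(\max_{0\le i\le\nu}S_i)\vee m_0$ and $X_\nu:=M_\nu/S_\nu\ge1$. Put $\widetilde p:=\alpha\lambda p$, $\widetilde q:=\alpha\lambda^{-1}q$ (so $\widetilde p+\widetilde q=1$), and for functions $\varphi$ on $[1,\infty)$ let $(\mathcal B\varphi)(x):=\widetilde p\,\varphi((\lambda^{-1}x)\vee1)+\widetilde q\,\varphi(\lambda x)$. With $g(x):=x$, define on $[1,\infty)$: $V^{[0]}_n\equiv0$, $V^{[m]}_0=g$ ($m\ge1$), and for $n,m\ge1$ $$V^{[m]}_n(x)=\max\{g(x)+(\mathcal BV^{[m-1]}_{n-1})(x),\ (\mathcal BV^{[m]}_{n-1})(x)\}.$$ Put $\Delta V^{[m]}_n:=V^{[m]}_n-V^{[m-1]}_n$, $f^{[m]}_n:=\mathcal B\Delta V^{[m]}_{n-1}$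 ($n\ge1$), $f^{[m]}_0:=0$. Admissible exercise vectors: let $\partial:=+\infty$ denote non-exercise. $\mathcal T^{[m]}_0$ is the set of vectors $(\sigma_m,\dots,\sigma_1)$ of $(\mathcal F_\nu)$-stopping times with values in $\{0,\dots,N\}\cup\{\partial\}$ such that, pathwise, for some $\ell\in\{0,\dots,m\}$ (possibly depending on $\omega$) the finite coordinates are exactly $\sigma_m,\dots,\sigma_{m-\ell+1}$, with $0\le\sigma_m<\sigma_{m-1}<\dots<\sigma_{m-\ell+1}\le N$, and the remaining coordinates equal $\partial$. *)

(* Defs.v *)
From mathcomp Require Import all_boot all_order all_algebra.
From mathcomp Require Import all_classical all_reals all_analysis.

Set Implicit Arguments.
Unset Strict Implicit.
Unset Printing Implicit Defensive.

Import Order.TTheory GRing.Theory Num.Theory.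
Import numFieldNormedType.Exports.

Local Open Scope classical_set_scope.
Local Open Scope ring_scope.

(* Functions on [1, +oo[ are represented by total functions R -> R; the
   operator calB only evaluates its argument on [1, +oo[ when 1 <= x (1 < lam),
   so values below 1 never matter. *)
Section Recursion.
Context {R : realType} (r lam : R).

Definition alpha : R := (1 + r)^-1.

Definition pup : R := ((1 + r) - lam^-1) / (lam - lam^-1).
Definition qdown : R := 1 - pup.

Definition ptilde : R := alpha * lam * pup.
Definition qtilde : R := alpha * lam^-1 * qdown.

Definition calB (phi : R -> R) (x : R) : R :=
  ptilde * phi (Num.max (lam^-1 * x) 1) + qtilde * phi (lam * x).

Definition g (x : R) : R := x.

Fixpoint V (m n : nat) {struct n} : R -> R :=
  match m, n with
  | 0%N, _ => fun=> 0
  | _.+1, 0%N => g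
  | m'.+1, n'.+1 =>
      fun x => Num.max (g x + calB (V m' n') x) (calB (V m'.+1 n') x)
  end.

(* Used for m >= 1 only, as are f, xstar and D below. *)
Definition DeltaV (m n : nat) (x : R) : R := V m n x - V m.-1 n x.

Definition f (m n : nat) : R -> R :=
  if n is n'.+1 then calB (DeltaV m n') else fun=> 0.

(* Exercise region. *)
Definition D (m n : nat) : set R := [set x | 1 <= x /\ f m n x <= x].

Definition xstar (m n : nat) : R := inf (D m n).

End Recursion.

(* Mutual independence of a finite family of real random variables. *)
Definition mutually_independent {R : realType} {d : measure_display}
    {T : measurableType d} (P : probability T R) (I : finType)
    (Y : I -> {RV P >-> R}) : Prop :=
  forall (J : {set I}) (B : I -> set R), (forall i, measurable (B i)) ->
    (P (\bigcap_(i in [set` J]) (Y i @^-1` B i)) =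
     \prod_(i in J) P (Y i @^-1` B i))%E.

(* The index i : 'I_N stands for the (i+1)-st increment. *)
Definition iid_steps {R : realType} {d : measure_display}
    {T : measurableType d} (P : probability T R) (r lam : R) (N : nat)
    (eps : 'I_N -> {RV P >-> R}) : Prop :=
  [/\ mutually_independent eps,
      forall i, P (eps i @^-1` [set 1]) = (pup r lam)%:E &
      forall i, P (eps i @^-1` [set -1]) = (qdown r lam)%:E].

Section Model.
Context {R : realType} {d : measure_display} {T : measurableType d}.
Context {P : probability T R} (r lam s0 m0 : R) {N : nat}.
Context (eps : 'I_N -> {RV P >-> R}).

Definition price (nu : nat) (w : T) : R :=
  s0 * lam `^ (\sum_(i < N | (i < nu)%N) eps i w).

Definition runmax (nu : nat) (w : T) : R := \big[Num.max/m0]_(i < nu.+1) price i w.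

Definition ratio (nu : nat) (w : T) : R := runmax nu w / price nu w.

Definition filtration (nu : nat) : set (set T) :=
  g_sigma_preimage (fun i : 'I_nu.+1 => price i).

(* Exercise dates take values in {0, ..., N} together with the non-exercise
   symbol, which is None and is larger than every finite date. *)
Definition date : Type := option 'I_N.+1.

Definition date_le (t : date) (nu : nat) : bool :=
  if t is Some k then (k <= nu)%N else false.

Definition date_lt (t : date) (nu : nat) : bool :=
  if t is Some k then (k < nu)%N else false.

Definition stopping_time (tau : T -> date) : Prop :=
  forall nu : 'I_N.+1, filtration nu [set w | date_le (tau w) nu].

(* A vector (sigma_m, ..., sigma_1) is a family indexed by nat, of which only
   the entries 1, ..., m are relevant. *)
Definition admissible (m : nat) : set (nat -> T -> date) :=
  [set sigma |
    (forall i, (1 <= i <= m)%N -> stopping_time (sigma i)) /\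
    forall w, exists2 l, (l <= m)%N &
      (forall i, (1 <= i <= m)%N ->
         (sigma i w != None) = (m - l + 1 <= i)%N) /\
      (forall i j (a b : 'I_N.+1), (1 <= i)%N -> (i < j)%N -> (j <= m)%N ->
         sigma i w = Some a -> sigma j w = Some b -> (b < a)%N)].

Definition payoff (m : nat) (sigma : nat -> T -> date) (w : T) : R :=
  \sum_(1 <= i < m.+1)
    (if sigma i w is Some k then alpha r ^+ k * runmax k w else 0).

(* Minimum of a set of dates, None if it is empty: enum 'I_N.+1 is listed in
   increasing order. *)
Definition first_date (A : pred 'I_N.+1) : date :=
  ohead [seq nu <- enum 'I_N.+1 | A nu].

(* threshold_seq m j is the exercise date of the right with label m - j. *)
Fixpoint threshold_seq (m j : nat) (w : T) : date :=
  match j with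
  | 0%N => first_date (fun nu => xstar r lam m (N - nu) <= ratio nu w)
  | j'.+1 => first_date (fun nu =>
      date_lt (threshold_seq m j' w) nu &&
      (xstar r lam (m - j) (N - nu) <= ratio nu w))
  end.

Definition sigma_star (m i : nat) : T -> date := threshold_seq m (m - i).

End Model.

(* Main.v *)
Require Import Defs.
From mathcomp Require Import all_boot all_order all_algebra.
From mathcomp Require Import all_classical all_reals all_analysis.
From mathcomp Require Import measurable_realfun.
From mathcomp Require Import ring lra zify.

Set Implicit Arguments.
Unset Strict Implicit.
Unset Printing Implicit Defensive.

Import Order.TTheory GRing.Theory Num.Theory.
Import numFieldNormedType.Exports.

Local Open Scope classical_set_scope.
Local Open Scope ring_scope.

(** The increment of V in the number of rights satisfies
    DeltaV 1 n = max (x, f 1 n) and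
    DeltaV m.+2 n = max (f m.+2 n, min (x, f m.+1 n)).
    Since calB maps nondecreasing 1-Lipschitz functions to nondecreasing
    alpha-Lipschitz ones, induction on n shows that every f m n is nondecreasing
    with slopes at most alpha, nonincreasing in m and nondecreasing in n; the
    exercise regions and thresholds are read off from this.

    For the stopping problem, every event of the filtration depends on the
    price history only, so expected payoffs are finite weighted sums over the
    2^N sign patterns. Along an exercise rule, the cash received so far plus the
    value s V(K, N - k)(m / s) of the K remaining rights does not increase on
    average from date k to date k.+1, by the recursion for V, and is constant on
    average when each exercise decision attains the maximum in that
    recursion, which is what the threshold rule does. *)

(** * Nondecreasing Lipschitz functions on the half-line from 1 *)

Section Slopes.
Context {R : realType}.

(** The lower bound encodes monotonicity, the upper bound the Lipschitz constant [c]; the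
    restriction to [1 <= x] reflects the range of the ratio X. *)
Definition slope_within (c : R) (phi : R -> R) : Prop :=
  forall x y, 1 <= x -> x <= y -> 0 <= phi y - phi x <= c * (y - x).

Lemma slope_within_le c c' phi :
  c <= c' -> slope_within c phi -> slope_within c' phi.
Proof. by move=> cc' h x y x1 xy; have := h x y x1 xy; nra. Qed.

Lemma slope_within_max c phi psi : slope_within c phi -> slope_within c psi ->
  slope_within c (fun x => Num.max (phi x) (psi x)).
Proof.
move=> h1 h2 x y x1 xy; have := h1 x y x1 xy; have := h2 x y x1 xy.
by case: (leP (phi x)); case: (leP (phi y)); lra.
Qed.

Lemma slope_within_min c phi psi : slope_within c phi -> slope_within c psi ->
  slope_within c (fun x => Num.min (phi x) (psi x)).
Proof.
move=> h1 h2 x y x1 xy; have := h1 x y x1 xy; have := h2 x y x1 xy.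
by case: (leP (phi x)); case: (leP (phi y)); lra.
Qed.

Lemma slope_within_id : slope_within 1 (fun x : R => x).
Proof. by move=> x y x1 xy; rewrite mul1r lexx subr_ge0 xy. Qed.

Lemma slope_within_cst c (a : R) : 0 <= c -> slope_within c (fun=> a).
Proof. by move=> c0 x y x1 xy; rewrite subrr lexx mulr_ge0 // subr_ge0. Qed.

Lemma slope_within_ext c phi psi : (forall x, 1 <= x -> phi x = psi x) ->
  slope_within c phi -> slope_within c psi.
Proof.
by move=> e h x y x1 xy; rewrite -!e //; [exact: h|exact: le_trans xy].
Qed.

End Slopes.

(** * The recursion for V, the exercise regions and the thresholds *)

Section ExerciseRegion.
Context {R : realType} (r lam : R).
Hypotheses (r_gt0 : 0 < r) (lam_gt1 : 1 < lam).
Hypotheses (no_arb_lo : lam^-1 < 1 + r) (no_arb_hi : 1 + r < lam).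

Let lam_gt0 : 0 < lam.
Proof. exact: lt_trans lam_gt1. Qed.

Let inv_gt0 : 0 < lam^-1.
Proof. by rewrite invr_gt0. Qed.

Lemma alpha_gt0 : 0 < alpha r.
Proof. by rewrite /alpha invr_gt0 ltr_wpDr // ltW. Qed.

Lemma alpha_lt1 : alpha r < 1.
Proof. by rewrite /alpha invf_lt1 ?ltrDl // ltr_wpDr // ltW. Qed.

Let spread_gt0 : 0 < lam - lam^-1.
Proof. by rewrite subr_gt0; exact: lt_trans no_arb_hi. Qed.

Lemma pup_gt0 : 0 < pup r lam.
Proof. by rewrite /pup divr_gt0 // subr_gt0. Qed.

Lemma qdown_gt0 : 0 < qdown r lam.
Proof. by rewrite /qdown subr_gt0 /pup ltr_pdivrMr // mul1r ltrD2r. Qed.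

Lemma ptilde_gt0 : 0 < ptilde r lam.
Proof. by rewrite /ptilde mulr_gt0 ?pup_gt0 // mulr_gt0 // alpha_gt0. Qed.

Lemma qtilde_gt0 : 0 < qtilde r lam.
Proof. by rewrite /qtilde mulr_gt0 ?qdown_gt0 // mulr_gt0 // alpha_gt0. Qed.

(** The factors [lam] and [lam^-1] inside the tilted weights cancel, which leaves alpha (p + q). *)
Lemma tilde_slope : ptilde r lam * lam^-1 + qtilde r lam * lam = alpha r.
Proof.
by rewrite /ptilde /qtilde /qdown; field; exact: lt0r_neq0.
Qed.

(** The up branch max (lam^-1 x, 1) has slopes at most [lam^-1] and the down branch has slope [lam];
    weighting them gives the sum in [tilde_slope]. *)
Lemma calB_slope phi :
  slope_within 1 phi -> slope_within (alpha r) (calB r lam phi).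
Proof.
move=> h x y x1 xy; rewrite /calB.
have l1 := lam_gt1; have i0 := inv_gt0.
have pt := ptilde_gt0; have qt := qtilde_gt0.
have h1 : 1 <= lam * x by nra.
have h2 : lam * x <= lam * y by nra.
have h3 : 1 <= Num.max (lam^-1 * x) 1 by rewrite le_max lexx orbT.
have h4 : 0 <= Num.max (lam^-1 * y) 1 - Num.max (lam^-1 * x) 1
  <= lam^-1 * (y - x).
  have : lam^-1 * x <= lam^-1 * y by nra.
  by case: (leP (lam^-1 * x) 1); case: (leP (lam^-1 * y) 1); lra.
have h5 : Num.max (lam^-1 * x) 1 <= Num.max (lam^-1 * y) 1 by lra.
have {h3 h5} /andP[u0 u1] := h _ _ h3 h5.
have {h1 h2} /andP[d0 d1] := h _ _ h1 h2.
rewrite -tilde_slope.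
have := mulr_ge0 (ltW pt) u0; have := mulr_ge0 (ltW qt) d0.
rewrite -subr_ge0 in d1; rewrite -subr_ge0 in u1.
have := mulr_ge0 (ltW pt) u1; have := mulr_ge0 (ltW qt) d1.
case/andP: h4 => _; rewrite -subr_ge0 => h4; have := mulr_ge0 (ltW pt) h4.
by lra.
Qed.

Lemma calB_le phi psi (x : R) : (forall y, 1 <= y -> phi y <= psi y) ->
  1 <= x -> calB r lam phi x <= calB r lam psi x.
Proof.
move=> h x1; rewrite /calB lerD // ler_pM2l ?ptilde_gt0 ?qtilde_gt0 //.
  by apply: h; rewrite le_max lexx orbT.
by apply: h; have := lam_gt1; nra.
Qed.

Lemma calB0 (x : R) : calB r lam (fun=> 0) x = 0.
Proof. by rewrite /calB !mulr0 addr0. Qed.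

Lemma calBB phi psi (x : R) :
  calB r lam (fun y => phi y - psi y) x = calB r lam phi x - calB r lam psi x.
Proof. by rewrite /calB; ring. Qed.

Lemma calB_ext phi psi (x : R) : (forall y, 1 <= y -> phi y = psi y) ->
  1 <= x -> calB r lam phi x = calB r lam psi x.
Proof.
by move=> h x1; apply/le_anti; rewrite !calB_le // => y /h ->.
Qed.

Local Notation V := (V r lam).
Local Notation f := (f r lam).
Local Notation DeltaV := (DeltaV r lam).

Lemma V0 n (x : R) : V 0 n x = 0.
Proof. by case: n. Qed.

(** Pulling [calB (V m n) x] out of the maximum leaves a difference of two continuation values,
    which is [f] by linearity of [calB]. *)
Lemma V_f m n (x : R) :
  V m.+1 n.+1 x = calB r lam (V m n) x + Num.max x (f m.+1 n.+1 x).
Proof.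
rewrite /= /g calBB /=.
by case: leP => h1; case: leP => h2; lra.
Qed.

Lemma DeltaV1 n (x : R) : 1 <= x -> DeltaV 1 n x = Num.max x (f 1 n x).
Proof.
move=> x1; rewrite /Defs.DeltaV V0 subr0; case: n => [|n].
  by rewrite /= /g max_l //; lra.
rewrite V_f (@calB_ext _ (fun=> 0)) ?calB0 ?add0r // => y _; exact: V0.
Qed.

(* The common term calB (V m.+1 n) cancels, since V m.+1 n.+1 x also equals
   calB (V m.+1 n) x + max (x - f m.+1 n.+1 x, 0). *)
Lemma DeltaV_step m n (x : R) : 1 <= x -> f m.+2 n x <= f m.+1 n x ->
  DeltaV m.+2 n x = Num.max (f m.+2 n x) (Num.min x (f m.+1 n x)).
Proof.
move=> x1; rewrite /Defs.DeltaV; case: n => [|n].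
  by rewrite /= /g subrr min_r ?maxxx //; lra.
move=> h; rewrite [in X in X - _]V_f [in X in _ - X]V_f.
have : f m.+1 n.+1 x = calB r lam (V m.+1 n) x - calB r lam (V m n) x.
  by rewrite /= calBB.
by case: (leP x (f m.+1 n.+1 x)) => ?; case: (leP x (f m.+2 n.+1 x)) => ?;
  do ?[case: leP => ?]; lra.
Qed.

(** By induction on n, both arguments of the outer maximum in [DeltaV_step] are at most [f m.+1 n],
    which in turn is at most [DeltaV m.+1 n]; the induction hypothesis also supplies the premise of
    [DeltaV_step]. *)
Lemma f_antitone m n (x : R) : 1 <= x -> f m.+2 n x <= f m.+1 n x.
Proof.
elim: n m x => [//|n IH] m x x1 /=; apply: calB_le => // y y1.
rewrite DeltaV_step //; last exact: IH.
case: m => [|m]; first rewrite DeltaV1 //.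
  by rewrite ge_max !le_max IH // ge_min lexx orbT.
rewrite DeltaV_step //; last exact: IH.
by rewrite ge_max !le_max IH // ge_min lexx orbT.
Qed.

Lemma DeltaVSS m n (x : R) : 1 <= x ->
  DeltaV m.+2 n x = Num.max (f m.+2 n x) (Num.min x (f m.+1 n x)).
Proof. by move=> x1; rewrite DeltaV_step //; exact: f_antitone. Qed.

Lemma f_slope m n : slope_within (alpha r) (f m.+1 n).
Proof.
have a0 := alpha_gt0; have a1 := alpha_lt1.
elim: n m => [|n IH] m /=; first by apply: slope_within_cst; lra.
(* Relaxing alpha to 1 gives [f] the same slope bound as the identity, with which it is combined in
   [DeltaV]. *)
have F k : slope_within 1 (f k.+1 n) by apply: slope_within_le (IH k); lra.
apply: calB_slope; case: m => [|m].
  apply: (@slope_within_ext _ _ (fun x => Num.max x (f 1 n x))).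
    by move=> x x1; rewrite DeltaV1.
  exact: (slope_within_max slope_within_id).
apply: (@slope_within_ext _ _
  (fun x => Num.max (f m.+2 n x) (Num.min x (f m.+1 n x)))).
  by move=> x x1; rewrite DeltaVSS.
by apply: slope_within_max => //; exact: (slope_within_min slope_within_id).
Qed.

Lemma f_homo m n (x : R) : 1 <= x -> f m.+1 n x <= f m.+1 n.+1 x.
Proof.
have B0 phi y : (forall z, 1 <= z -> 0 <= phi z) -> 1 <= y ->
    0 <= calB r lam phi y.
  by move=> h y1; rewrite -(calB0 y); exact: calB_le.
elim: n m x => [|n IH] m x x1.
  (* Since [f] vanishes at n = 0, the base case only asks that [DeltaV] be nonnegative there. *)
  apply: B0 => // y y1; case: m => [|m].
    by rewrite DeltaV1 // le_max (le_trans ler01).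
  by rewrite DeltaVSS // le_max lexx.
apply: calB_le => // y y1; case: m => [|m].
  rewrite !DeltaV1 // ge_max !le_max lexx /=.
  by rewrite IH ?orbT.
rewrite !DeltaVSS // ge_max !le_max IH //= le_min !ge_min lexx IH //=.
by rewrite !orbT.
Qed.

Lemma f_secant m n (x y : R) : 1 <= x -> x < y ->
  (1 - alpha r) * (y - x) <= (y - f m.+1 n y) - (x - f m.+1 n x).
Proof. by move=> x1 xy; have := @f_slope m n _ _ x1 (ltW xy); lra. Qed.

Lemma f_increasing m n (x y : R) : 1 <= x -> x < y ->
  x - f m.+1 n x < y - f m.+1 n y.
Proof.
move=> x1 xy; rewrite -subr_gt0; apply: lt_le_trans (f_secant m n x1 xy).
by rewrite mulr_gt0 ?subr_gt0 ?alpha_lt1.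
Qed.

Lemma f_secant_slope m n (x y : R) : 1 <= x -> x < y ->
  1 - alpha r <= ((y - f m.+1 n y) - (x - f m.+1 n x)) / (y - x).
Proof. by move=> x1 xy; rewrite ler_pdivlMr ?subr_gt0 //; exact: f_secant. Qed.

Lemma f_gap_cvg m n : x - f m.+1 n x @[x --> +oo] --> +oo.
Proof.
have a1 := alpha_lt1.
apply/cvgryPge => A; near=> x.
have x1 : 1 < x by near: x; exact: nbhs_pinfty_gt.
have := f_secant m n (lexx 1) x1.
(* From here on the secant bound started at 1 raises the gap x - f by at least its shortfall from
   A. *)
have : 1 + `|A - (1 - f m.+1 n 1)| / (1 - alpha r) <= x.
  by near: x; apply: nbhs_pinfty_ge; rewrite num_real.
rewrite -lerBrDl ler_pdivrMr ?subr_gt0 // (mulrC (x - 1)).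
by have := ler_norm (A - (1 - f m.+1 n 1)); lra.
Unshelve. all: by end_near. Qed.

Lemma D_has_inf m n : has_inf (D r lam m.+1 n).
Proof.
split; last by exists 1 => x [].
have a1 := alpha_lt1.
(* With this x the secant bound from 1 adds at least |f 1| to the gap 1 - f 1, making it
   nonnegative. *)
pose x := 2 + `|f m.+1 n 1| / (1 - alpha r).
have h0 : 0 <= `|f m.+1 n 1| / (1 - alpha r).
  by rewrite divr_ge0 // subr_ge0 ltW.
have x1 : 1 < x by rewrite /x; lra.
exists x; split; first exact: ltW.
have := f_secant m n (lexx 1) x1.
have -> : (1 - alpha r) * (x - 1) = (1 - alpha r) + `|f m.+1 n 1|.
  by rewrite /x; field; rewrite subr_eq0 eq_sym lt_eqF.
by have := ler_norm (f m.+1 n 1); lra.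
Qed.

Lemma xstar_ge1 m n : 1 <= xstar r lam m.+1 n.
Proof. by apply: lb_le_inf => [|x []//]; exact: (D_has_inf m n).1. Qed.

(* Monotonicity of f suffices for the infimum to be attained: if f exceeded
   x at the infimum, it would do so at nearby points of D too. *)
Lemma D_interval m n :
  D r lam m.+1 n = `[xstar r lam m.+1 n, +oo[%classic.
Proof.
have [D0 Dlb] := D_has_inf m n; have x1 := xstar_ge1 m n.
have Dstar : f m.+1 n (xstar r lam m.+1 n) <= xstar r lam m.+1 n.
  rewrite leNgt; apply/negP => lt; rewrite -subr_gt0 in lt.
  have [y [y1 fy] ylt] := inf_adherent lt (conj D0 Dlb).
  have ge : xstar r lam m.+1 n <= y by exact: ge_inf.
  have := @f_slope m n _ _ x1 ge.
  by move: ylt; rewrite -/(xstar r lam m.+1 n); lra.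
apply/seteqP; split => x /=; rewrite in_itv /= andbT.
  by move=> Dx; exact: ge_inf.
move=> ge; split; first exact: le_trans ge.
move: ge; rewrite le_eqVlt => /predU1P[<-//|lt].
by have := f_increasing m n x1 lt; lra.
Qed.

(** This is how the thresholds inherit their monotonicity: comparing two of them reduces to
    comparing values of [f] at one point. *)
Lemma xstar_le m n (x : R) : 1 <= x ->
  (xstar r lam m.+1 n <= x) = (f m.+1 n x <= x).
Proof.
move=> x1; apply/idP/idP => h.
  have : D r lam m.+1 n x by rewrite D_interval /= in_itv /= h.
  by case.
have : D r lam m.+1 n x by [].
by rewrite D_interval /= in_itv /= andbT.
Qed.

Lemma xstar0 m : xstar r lam m.+1 0 = 1.
Proof. by apply/le_anti; rewrite xstar_ge1 andbT xstar_le. Qed.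

Lemma f_xstar m n : f m.+1 n (xstar r lam m.+1 n) <= xstar r lam m.+1 n.
Proof. by rewrite -xstar_le // xstar_ge1. Qed.

Lemma xstar_homo m n : xstar r lam m.+1 n <= xstar r lam m.+1 n.+1.
Proof.
have x1 := xstar_ge1 m n.+1.
by rewrite xstar_le //; apply: le_trans (f_homo m n x1) (f_xstar m n.+1).
Qed.

Lemma xstar_antitone m n : xstar r lam m.+2 n <= xstar r lam m.+1 n.
Proof.
have x1 := xstar_ge1 m n.
by rewrite xstar_le //; apply: le_trans (f_antitone m n x1) (f_xstar m n).
Qed.

Lemma D_sub m n : D r lam m.+1 n `<=` D r lam m.+2 n.
Proof.
by move=> x [x1 fx]; split => //; apply: le_trans fx; exact: f_antitone.
Qed.

(** The flag [e] records whether a right is exercised now; its two values select the two entries of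
    the maximum in the recursion. *)
Lemma V_exercise_le m n (x : R) (e : bool) : (e <= m)%N ->
  e%:R * x + calB r lam (V (m - e) n) x <= V m n.+1 x.
Proof.
case: m => [|m]; case: e => //= _.
- rewrite mul0r add0r /calB !V0 !mulr0 addr0 //.
- by rewrite subn1 /= mul1r le_max lexx.
- by rewrite subn0 mul0r add0r le_max lexx orbT.
Qed.

(** At or above the threshold x dominates [f], so exercising attains the maximum in [V_f]; below it,
    waiting does. *)
Lemma V_exercise_eq m n (x : R) : 1 <= x ->
  let e := (0 < m)%N && (xstar r lam m n.+1 <= x) in
  e%:R * x + calB r lam (V (m - e) n) x = V m n.+1 x.
Proof.
move=> x1; case: m => [|m].
  by rewrite /= mul0r add0r /calB !V0 !mulr0 addr0.
rewrite xstar_le // V_f ltn0Sn andTb /=.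
have : f m.+1 n.+1 x = calB r lam (V m.+1 n) x - calB r lam (V m n) x.
  by rewrite /= calBB.
case: leP => h fE; rewrite ?subn1 ?subn0 /= ?mul1r ?mul0r; first exact: addrC.
by rewrite /= in fE; lra.
Qed.

End ExerciseRegion.

(** * Weighted means over sign patterns *)

Section Coins.
Context {R : realType} (p q : R) {N : nat}.
Hypothesis pq1 : p + q = 1.
Hypotheses (p_ge0 : 0 <= p) (q_ge0 : 0 <= q).

Local Notation coins := {ffun 'I_N -> bool}.

Definition toss (v : bool) : R := if v then p else q.

Definition weight (b : coins) : R := \prod_i toss (b i).

Definition mean (H : coins -> R) : R := \sum_b weight b * H b.

Definition update (b : coins) (k : 'I_N) (v : bool) : coins :=
  [ffun i => if i == k then v else b i].

Lemma weight_ge0 b : 0 <= weight b.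
Proof. by apply: prodr_ge0 => i _; rewrite /toss; case: ifP. Qed.

(** Flipping coin k is an involution that exchanges the patterns with value true at k and those with
    value false. *)
Lemma sum_coins_split (k : 'I_N) (F : coins -> R) :
  \sum_b F b = \sum_(b : coins | b k) (F b + F (update b k false)).
Proof.
pose flip (b : coins) := update b k (~~ b k).
have flipK : involutive flip.
  move=> b; apply/ffunP => i; rewrite !ffunE eqxx.
  by case: eqP => // ->; rewrite negbK.
rewrite (bigID (fun b : coins => b k)) big_split /=; congr (_ + _).
rewrite (reindex_inj (inv_inj flipK)) /=; apply: eq_big => b.
  by rewrite ffunE eqxx negbK.
by rewrite /flip ffunE eqxx negbK => ->.
Qed.

Lemma weight_update b k v :
  weight (update b k v) = toss v * \prod_(i | i != k) toss (b i).
Proof.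
rewrite /weight (bigD1 k) //= ffunE eqxx; congr (_ * _).
by apply: eq_bigr => i /negbTE ik; rewrite ffunE ik.
Qed.

Lemma update_id b k : update b k (b k) = b.
Proof. by apply/ffunP => i; rewrite ffunE; case: eqP => // ->. Qed.

Lemma update_update b k u v : update (update b k u) k v = update b k v.
Proof. by apply/ffunP => i; rewrite !ffunE; case: eqP. Qed.

(** Averaging out coin k plays the role of conditioning: two paired patterns share all other factors
    of their weights, and p + q = 1. *)
Lemma mean_tower k H :
  mean H = mean (fun b => p * H (update b k true) + q * H (update b k false)).
Proof.
rewrite /mean !(sum_coins_split k); apply: eq_bigr => b bk.
have bt : update b k true = b by rewrite -bk update_id.
have wb := weight_update b k true; rewrite bt in wb.
rewrite !update_update bt wb weight_update /=.
by have -> : q = 1 - p; [have := pq1; lra|ring].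
Qed.

(** By distributivity the total weight factors into N copies of p + q. *)
Lemma mean_cst (c : R) : mean (fun=> c) = c.
Proof.
rewrite /mean -mulr_suml -[RHS]mul1r; congr (_ * _).
rewrite /weight -(bigA_distr_bigA (fun (_ : 'I_N) v => toss v)) /=.
by rewrite big1 // => i _; rewrite big_bool.
Qed.

Lemma mean_le H H' : (forall b, H b <= H' b) -> mean H <= mean H'.
Proof. by move=> h; apply: ler_sum => b _; rewrite ler_wpM2l ?weight_ge0. Qed.

End Coins.

(** * Exercise dates and the rights spent on each date *)

Section Dates.
Context {R : realType} {d : measure_display} {T : measurableType d}.
Context {P : probability T R} (r lam s0 m0 : R) {N : nat}.
Context (eps : 'I_N -> {RV P >-> R}).

Definition date_at (t : @date N) (k : nat) : bool :=
  if t is Some j then j == k :> nat else false.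

Lemma date_atE (t : @date N) k : date_at t k = date_le t k && ~~ date_lt t k.
Proof. by case: t => [j|//] /=; lia. Qed.

Lemma date_lt_le (t : @date N) k : date_lt t k.+1 = date_le t k.
Proof. by case: t. Qed.

Lemma date_lt0 (t : @date N) : date_lt t 0 = false.
Proof. by case: t. Qed.

Lemma date_ltS (t : @date N) k : date_lt t k.+1 = date_lt t k || date_at t k.
Proof. by case: t => [j|//] /=; lia. Qed.

Lemma date_at_some (t : @date N) (k : 'I_N.+1) : date_at t k = (t == Some k).
Proof. by case: t. Qed.

Lemma date_lt_trans (t : @date N) (j k : nat) :
  date_lt t j -> (j <= k)%N -> date_lt t k.
Proof. by case: t => [a|//] /=; exact: leq_trans. Qed.

Lemma date_ltN (t : @date N) : date_lt t N.+1 = (t != None).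
Proof. by case: t => [j|//] /=; rewrite ltn_ord. Qed.

(** The verification argument sees an exercise vector only through these counts. *)
Definition used (m : nat) (sigma : nat -> T -> @date N) (k : nat) (w : T) : nat
  := \sum_(1 <= i < m.+1) date_at (sigma i w) k.

Lemma payoff_used m sigma w : payoff r lam s0 m0 eps m sigma w =
  \sum_(k < N.+1)
    (used m sigma k w)%:R * (alpha r ^+ k * runmax lam s0 m0 eps k w).
Proof.
rewrite /payoff /used.
under [RHS]eq_bigr => k _ do rewrite natr_sum mulr_suml.
rewrite exchange_big /=; apply: eq_bigr => i _.
case: (sigma i w) => [j|] /=; last by rewrite big1 // => k _; rewrite mul0r.
rewrite (bigD1 j) //= eqxx mul1r big1 ?addr0 // => k /negbTE kj.
by rewrite eq_sym -val_eqE /= in kj; rewrite kj mul0r.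
Qed.

Lemma sum_used m sigma w k :
  (\sum_(j < k) used m sigma j w =
   \sum_(1 <= i < m.+1) date_lt (sigma i w) k)%N.
Proof.
elim: k => [|k IH].
  by rewrite big_ord0 big1 // => i _; rewrite date_lt0.
rewrite big_ord_recr /= IH -big_split /=; apply: eq_bigr => i _.
by rewrite date_ltS date_atE; case: date_lt; case: date_le.
Qed.

Lemma sum_used_le m sigma w k : (\sum_(j < k) used m sigma j w <= m)%N.
Proof.
rewrite sum_used; apply: leq_trans (_ : (\sum_(1 <= i < m.+1) 1 <= m)%N).
  by apply: leq_sum => i _; case: date_lt.
by rewrite sum_nat_const_nat; lia.
Qed.

End Dates.

(** * Price, running maximum, ratio and filtration along a path *)

Section Paths.
Context {R : realType} {d : measure_display} {T : measurableType d}.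
Context {P : probability T R} (r lam s0 m0 : R) {N : nat}.
Context (eps : 'I_N -> {RV P >-> R}).
Hypotheses (lam_gt0 : 0 < lam) (s0_gt0 : 0 < s0) (m0_ge : s0 <= m0).

Local Notation price := (Defs.price lam s0 eps).
Local Notation runmax := (Defs.runmax lam s0 m0 eps).
Local Notation ratio := (Defs.ratio lam s0 m0 eps).
Local Notation coins := {ffun 'I_N -> bool}.

Lemma price_gt0 k w : 0 < price k w.
Proof. by rewrite mulr_gt0 ?powR_gt0. Qed.

Lemma price0 w : price 0 w = s0.
Proof. by rewrite /Defs.price big1 ?powRr0 ?mulr1. Qed.

Lemma priceS (k : 'I_N) w : price k.+1 w = price k w * lam `^ eps k w.
Proof.
have -> : price k.+1 w =
    s0 * lam `^ (\sum_(i < N | (i < k)%N) eps i w + eps k w).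
  congr (_ * _ `^ _); rewrite (bigD1 k) //= addrC; congr (_ + _).
  by apply: eq_bigl => i; rewrite ltnS [in RHS]ltn_neqAle andbC.
by rewrite powRD ?mulrA // lt0r_neq0 ?implybT.
Qed.

Lemma runmax0 w : runmax 0 w = m0.
Proof. by rewrite /Defs.runmax big_ord_recl big_ord0 price0 max_r. Qed.

Lemma runmaxS k w : runmax k.+1 w = Num.max (runmax k w) (price k.+1 w).
Proof.
apply/le_anti/andP; split.
  apply/bigmax_leP; split=> [|i _]; first by rewrite le_max bigmax_ge_id.
  have [ik|ik] := ltnP i k.+1; rewrite le_max.
    by rewrite (le_bigmax _ (fun j : 'I_k.+1 => price j w) (Ordinal ik)).
  have -> : nat_of_ord i = k.+1 by apply/eqP; rewrite eqn_leq ik -ltnS ltn_ord.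
  by rewrite lexx orbT.
rewrite ge_max (le_bigmax _ (fun j : 'I_k.+2 => price j w) ord_max) andbT.
apply/bigmax_leP; split=> [|i _]; first exact: bigmax_ge_id.
exact: (le_bigmax _ (fun j : 'I_k.+2 => price j w) (widen_ord (leqnSn _) i)).
Qed.

Lemma price_le_runmax k w : price k w <= runmax k w.
Proof. exact: (le_bigmax _ (fun j : 'I_k.+1 => price j w) ord_max). Qed.

Lemma runmax_gt0 k w : 0 < runmax k w.
Proof. exact: lt_le_trans (price_gt0 k w) (price_le_runmax k w). Qed.

Lemma ratio_ge1 k w : 1 <= ratio k w.
Proof. by rewrite ler_pdivlMr ?price_gt0 // mul1r price_le_runmax. Qed.

Lemma runmaxE k w : runmax k w = price k w * ratio k w.
Proof. by rewrite /Defs.ratio mulrC divfK // gt_eqF ?price_gt0. Qed.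

Definition step (v : bool) : R := if v then 1 else -1.

Definition path_event (b : coins) : set T :=
  [set w | forall i, eps i w = step (b i)].

(** A rise divides the ratio by [lam], unless the new price reaches the old maximum, when the ratio
    becomes 1. *)
Lemma ratio_up (k : 'I_N) w : eps k w = 1 ->
  ratio k.+1 w = Num.max (lam^-1 * ratio k w) 1.
Proof.
move=> e; have p0 := price_gt0 k w.
have pl : 0 < price k w * lam by exact: mulr_gt0.
rewrite /Defs.ratio runmaxS priceS e powRr1 ?(ltW lam_gt0) //.
rewrite maxr_pMl ?invr_ge0 ?(ltW pl) // divff ?lt0r_neq0 //.
by congr Num.max; field; rewrite !lt0r_neq0.
Qed.

Lemma ratio_down (k : 'I_N) w : 1 < lam -> eps k w = -1 ->
  ratio k.+1 w = lam * ratio k w.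
Proof.
move=> lam_gt1 e; have p0 := price_gt0 k w.
(* A fall cannot set a new maximum, so the running maximum stays. *)
rewrite /Defs.ratio runmaxS priceS e powR_inv1 ?ltW // max_l; last first.
  apply: le_trans (price_le_runmax k w).
  by rewrite ger_pMr // invf_le1 // ltW.
by field; rewrite !gt_eqF.
Qed.

(** Counterpart on sign patterns of having the same information at date k: coin i moves the price
    from date i to date i + 1. *)
Definition agree_below (k : nat) (b b' : coins) : Prop :=
  forall i : 'I_N, (i < k)%N -> b i = b' i.

Lemma price_agree k b b' w w' : agree_below k b b' ->
  path_event b w -> path_event b' w' -> price k w = price k w'.
Proof.
move=> bb' bw bw'; congr (_ * _ `^ _); apply: eq_bigr => i ik.
by rewrite bw bw' bb'.
Qed.

Lemma agree_below_le j k b b' :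
  (j <= k)%N -> agree_below k b b' -> agree_below j b b'.
Proof. by move=> jk h i ij; apply: h; exact: leq_trans jk. Qed.

Lemma runmax_agree k b b' w w' : agree_below k b b' ->
  path_event b w -> path_event b' w' -> runmax k w = runmax k w'.
Proof.
move=> bb' bw bw'; apply: eq_bigr => i _; apply: price_agree bw bw'.
by apply: agree_below_le bb'; rewrite -ltnS.
Qed.

Lemma ratio_agree k b b' w w' : agree_below k b b' ->
  path_event b w -> path_event b' w' -> ratio k w = ratio k w'.
Proof.
move=> bb' bw bw'.
by rewrite /Defs.ratio (runmax_agree bb' bw bw') (price_agree bb' bw bw').
Qed.

Lemma measurable_price k : measurable_fun setT (price k).
Proof.
apply: measurable_funM => //; apply: (measurableT_comp (measurable_powRr lam)).
under eq_fun do rewrite big_mkcond; apply: measurable_sum => i.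
by case: (i < k)%N.
Qed.

Lemma measurable_runmax k : measurable_fun setT (runmax k).
Proof.
elim: k => [|k IH].
  by rewrite (funext runmax0); exact: measurable_cst.
rewrite (funext (runmaxS k)); apply: measurable_maxr => //.
exact: measurable_price.
Qed.

Lemma filtration_measurable k : filtration lam s0 eps k `<=` measurable.
Proof.
apply: smallest_sub; first exact: sigma_algebra_measurable.
rewrite -(bigcup_mkord _
  (fun i => preimage_set_system setT (price i) measurable)).
move=> _ [i _ [B mB <-]]; rewrite -[X in measurable X]setTI.
by rewrite setIA setTI; exact: measurable_price.
Qed.

(* Events of the filtration cannot separate outcomes with the same price
   history; this is how adaptedness of exercise rules is exploited. *)
Lemma filtration_saturated k E w w' : filtration lam s0 eps k E ->
  (forall i, (i <= k)%N -> price i w = price i w') -> E w -> E w'.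
Proof.
pose sat := [set E : set T | forall w w',
  (forall i, (i <= k)%N -> price i w = price i w') -> E w -> E w'].
suff /(_ E) h : filtration lam s0 eps k `<=` sat by move=> /h; exact.
apply: smallest_sub.
  split=> [? ? ? []|A hA u u' e [_ nAu]|A hA u u' e [n _ /hA]].
    by split=> // /hA Au; apply/nAu/Au => i ik; rewrite e.
  by move=> /(_ _ e) ?; exists n.
rewrite -(bigcup_mkord _
  (fun i => preimage_set_system setT (price i) measurable)).
by move=> _ [i /= ik [B mB <-]] u u' e [_ Bu]; split => //=; rewrite /= -e.
Qed.

End Paths.

(** * First dates and finite Boolean sequences *)

Lemma ohead_filter_spec n (A : pred 'I_n) (s : seq 'I_n) :
  sorted (fun i j : 'I_n => (i < j)%N) s ->
  if ohead [seq i <- s | A i] is Some a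
  then [/\ A a, a \in s & forall i, i \in s -> A i -> (a <= i)%N]
  else forall i, i \in s -> ~~ A i.
Proof.
(* The sorted sequence is arbitrary because tails of the enumeration are not themselves
   enumerations. *)
elim: s => [//|x s IH] /= xs.
have := IH (path_sorted xs); case Ax : (A x) => /=.
  move=> _; split => //; first exact: mem_head.
  move=> i; rewrite inE => /predU1P[->//|si _]; apply: ltnW.
  by have /allP := order_path_min (fun _ _ _ => @ltn_trans _ _ _) xs; exact.
case: ohead => [a [Aa sa min]|nA].
  split => // [|i]; first by rewrite inE sa orbT.
  by rewrite inE => /predU1P[->|/min //]; rewrite Ax.
by move=> i; rewrite inE => /predU1P[->|/nA //]; rewrite Ax.
Qed.

Lemma first_date_spec N (A : pred 'I_N.+1) :
  if first_date A is Some a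
  then A a /\ forall i, A i -> (a <= i)%N
  else forall i, ~~ A i.
Proof.
have := @ohead_filter_spec _ A (enum 'I_N.+1); rewrite -/(first_date A).
have -> : sorted (fun i j : 'I_N.+1 => (i < j)%N) (enum 'I_N.+1).
  rewrite -[sorted _ _]/(sorted (relpre val ltn) _) -sorted_map.
  by rewrite val_enum_ord iota_ltn_sorted.
case: first_date => [a /(_ isT)[Aa _ min]|/(_ isT) nA].
  by split => // i; apply: min; rewrite mem_enum.
by move=> i; apply: nA; rewrite mem_enum.
Qed.

Lemma first_date_lt N (A : pred 'I_N.+1) k :
  date_lt (first_date A) k = [exists i : 'I_N.+1, (i < k)%N && A i].
Proof.
have := first_date_spec A; case: first_date => [a [Aa min]|nA] /=.
  apply/idP/existsP => [ak|[i /andP[ik /min ai]]]; last exact: leq_ltn_trans ik.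
  by exists a; rewrite ak.
by apply/esym/existsP => -[i /andP[_]]; apply/negP.
Qed.

Lemma first_dateE N (A : pred 'I_N.+1) (k : 'I_N.+1) :
  (first_date A == Some k) = A k && ~~ date_lt (first_date A) k.
Proof.
have := first_date_spec A; case: first_date => [a [Aa min]|nA] /=.
  apply/eqP/andP => [[<-]|[/min ak]]; first by rewrite ltnn.
  by rewrite -leqNgt => ka; congr Some; apply/val_inj/eqP; rewrite eqn_leq ak.
by rewrite (negbTE (nA k)).
Qed.

(** The true entries form a final segment of 1, ..., m, so their number determines where it
    starts. *)
Lemma sum_monotone_bool m (a : nat -> bool) :
  (forall i j, (1 <= i)%N -> (i <= j)%N -> (j <= m)%N -> a i -> a j) ->
  forall i, (1 <= i <= m)%N -> a i = (m - \sum_(1 <= j < m.+1) a j < i)%N.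
Proof.
elim: m => [|m IH] mono i /andP[i1 im]; first by move: i1 im; case: i.
rewrite big_nat_recr //=.
have {}IH := IH (fun i j i1 ij jm => mono i j i1 ij (leqW jm)).
case E : (a m.+1).
  rewrite addn1 subSS; move: im; rewrite leq_eqVlt => /predU1P[->|im].
    by rewrite E ltnS leq_subr.
  by rewrite IH // i1.
have nA j : (1 <= j <= m.+1)%N -> a j = false.
  by move=> /andP[j1 jm]; apply: contraFF E; exact: mono.
rewrite big_nat_cond big1 ?nA ?i1 // => [|j]; first by lia.
by rewrite andbT => /andP[j1 jm]; rewrite nA // j1 ltnW.
Qed.

Lemma sum_exclusive_bool m (a : nat -> bool) :
  (forall i j, (1 <= i)%N -> (i < j)%N -> (j <= m)%N -> a i -> a j -> False) ->
  (\sum_(1 <= j < m.+1) a j <= 1)%N.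
Proof.
elim: m => [|m IH] excl; first by rewrite big_geq.
rewrite big_nat_recr //=; case E : (a m.+1); last first.
  by rewrite addn0; apply: IH => i j i1 ij jm; apply: excl => //; exact: leqW.
rewrite big_nat_cond big1 // => j; rewrite andbT => /andP[j1 jm].
by case F : (a j) => //; case: (excl j m.+1).
Qed.

(** * The threshold rule: admissibility and greediness *)

Section Thresholds.
Context {R : realType} {d : measure_display} {T : measurableType d}.
Context {P : probability T R} (r lam s0 m0 : R) {N : nat}.
Context (eps : 'I_N -> {RV P >-> R}).
Hypotheses (lam_gt0 : 0 < lam) (s0_gt0 : 0 < s0) (m0_ge : s0 <= m0).

Local Notation price := (Defs.price lam s0 eps).
Local Notation runmax := (Defs.runmax lam s0 m0 eps).
Local Notation ratio := (Defs.ratio lam s0 m0 eps).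
Local Notation filtration := (Defs.filtration lam s0 eps).
Local Notation sigma := (Defs.sigma_star r lam s0 m0 eps).
Local Notation threshold := (Defs.threshold_seq r lam s0 m0 eps).
(** Equipping T with the sigma-algebra generated by this family turns membership in [filtration k]
    into ordinary measurability. *)
Local Notation generators k := (\big[setU/set0]_(i < k.+1)
  preimage_set_system setT (price i) measurable).

Lemma measurable_past_price i k : (i <= k)%N ->
  measurable_fun setT (price i : g_sigma_algebraType (generators k) -> R).
Proof.
move=> ik _ B mB; apply: sub_sigma_algebra.
rewrite -(bigcup_mkord _
  (fun i => preimage_set_system setT (price i) measurable)).
by exists i => //; exists B.
Qed.

Lemma measurable_past_runmax i k : (i <= k)%N ->
  measurable_fun setT (runmax i : g_sigma_algebraType (generators k) -> R).
Proof.
elim: i => [|i IH] ik; first by rewrite (funext (runmax0 _ _ m0_ge)).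
rewrite (funext (runmaxS _ _ _ _ i)).
apply: measurable_maxr; last exact: measurable_past_price.
by apply: IH; exact: ltnW.
Qed.

Lemma filtration_ratio_ge i k c :
  (i <= k)%N -> filtration k [set w | c <= ratio i w].
Proof.
move=> ik.
(* Clearing the positive denominator avoids the measurability of a quotient. *)
have -> : [set w | c <= ratio i w] =
    setT `&` [set w | c * price i w <= runmax i w].
  by rewrite setTI; apply/seteqP; split => w /=;
    rewrite ler_pdivlMr ?price_gt0.
apply: (@measurable_fun_le _ (g_sigma_algebraType (generators k))) => //.
  by apply: measurable_funM => //; exact: measurable_past_price.
exact: measurable_past_runmax.
Qed.

(** Whether the first date is i depends on the predicate at dates up to i only. *)
Lemma filtration_first_date (A : T -> pred 'I_N.+1) k :
  (forall i : 'I_N.+1, (i <= k)%N -> filtration k [set w | A w i]) ->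
  forall i : 'I_N.+1, (i <= k)%N ->
    filtration k [set w | first_date (A w) == Some i].
Proof.
move=> mA i ik.
have -> : [set w | first_date (A w) == Some i] =
    [set w | A w i] `\` \bigcup_(j in [set j : 'I_N.+1 | (j < i)%N])
                          [set w | A w j].
  apply/seteqP; split => w /=; rewrite first_dateE first_date_lt.
    case/andP => Ai /existsPn nA; split => // -[j /= ji Aj].
    by have := nA j; rewrite ji Aj.
  case=> Ai nA; rewrite Ai; apply/existsPn => j; apply/negP => /andP[ji Aj].
  by apply: nA; exists j.
apply: (@measurableD _ (g_sigma_algebraType (generators k))); first exact: mA.
apply: (@fin_bigcup_measurable _ (g_sigma_algebraType (generators k))) => //.
by move=> j /= ji; apply: mA; exact: leq_trans (ltnW ji) ik.
Qed.

Lemma filtration_threshold m j k (i : 'I_N.+1) : (i <= k)%N ->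
  filtration k [set w | threshold m j w == Some i].
Proof.
elim: j i => [|j IH] i ik; apply: filtration_first_date => // {ik}i ik.
  exact: filtration_ratio_ge.
(* The previous right is traced back to its date l < i, to which the induction hypothesis
   applies. *)
have -> : [set w | date_lt (threshold m j w) i &&
      (xstar r lam (m - j.+1) (N - i) <= ratio i w)] =
    (\bigcup_(l in [set l : 'I_N.+1 | (l < i)%N])
       [set w | threshold m j w == Some l]) `&`
    [set w | xstar r lam (m - j.+1) (N - i) <= ratio i w].
  apply/seteqP; split => w /=.
    case/andP; case E : threshold => [l|//] /= li ->; split => //.
    by exists l => //=; rewrite E.
  by case=> -[l /= li /eqP ->] ->; rewrite /= li.
apply: (@measurableI _ (g_sigma_algebraType (generators k))).
  apply: (@fin_bigcup_measurable _ (g_sigma_algebraType (generators k))) => //.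
  by move=> l /= li; apply: IH; exact: leq_trans (ltnW li) ik.
exact: filtration_ratio_ge.
Qed.

Lemma stopping_time_sigma_star m i : stopping_time lam s0 eps (sigma m i).
Proof.
move=> k; have -> : [set w | date_le (sigma m i w) k] =
    \bigcup_(l in [set l : 'I_N.+1 | (l <= k)%N])
      [set w | sigma m i w == Some l].
  apply/seteqP; split => w /=.
    by case E : sigma_star => [l|//] /= lk; exists l => //=; rewrite E.
  by case=> l /= lk /eqP ->.
apply: (@fin_bigcup_measurable _ (g_sigma_algebraType (generators k))) => //.
by move=> l /= lk; exact: filtration_threshold.
Qed.

Lemma sigma_star_top m w : sigma m m w =
  first_date (fun k : 'I_N.+1 => xstar r lam m (N - k) <= ratio k w).
Proof. by rewrite /Defs.sigma_star subnn. Qed.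

Lemma sigma_star_rec m i w : (i < m)%N -> sigma m i w =
  first_date (fun k : 'I_N.+1 => date_lt (sigma m i.+1 w) k &&
    (xstar r lam i (N - k) <= ratio k w)).
Proof.
move=> im; rewrite /Defs.sigma_star; have -> : (m - i = (m - i.+1).+1)%N by lia.
by rewrite /=; have -> : (m - (m - i.+1).+1 = i)%N by lia.
Qed.

Lemma sigma_star_after m i w (a : 'I_N.+1) : (i < m)%N ->
  sigma m i w = Some a -> date_lt (sigma m i.+1 w) a.
Proof.
move=> im; rewrite sigma_star_rec // => /eqP.
by rewrite first_dateE => /andP[/andP[]].
Qed.

Lemma sigma_star_monotone m w k i j : (i <= j)%N -> (j <= m)%N ->
  date_lt (sigma m i w) k -> date_lt (sigma m j w) k.
Proof.
elim: j => [|j IH]; first by case: i.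
rewrite leq_eqVlt => /predU1P[->//|ij] jm hi.
have := IH ij (ltnW jm) hi; case E : (sigma m j w) => [a|//] /= ak.
by apply: date_lt_trans (ltnW ak); exact: sigma_star_after E.
Qed.

Lemma sigma_star_admissible m : admissible lam s0 eps m (sigma m).
Proof.
split=> [i _|w]; first exact: stopping_time_sigma_star.
have mono i j : (1 <= i)%N -> (i <= j)%N -> (j <= m)%N ->
    sigma m i w != None -> sigma m j w != None.
  by move=> _ ij jm; rewrite -!date_ltN; exact: sigma_star_monotone.
(* The witness counts the exercised rights; by [mono] their labels form a final segment. *)
exists (\sum_(1 <= j < m.+1) (sigma m j w != None))%N; last split.
- apply: leq_trans (_ : (\sum_(1 <= i < m.+1) 1 <= m)%N).
    by apply: leq_sum => i _; case: (_ != _).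
  by rewrite sum_nat_const_nat; lia.
- by move=> i im; rewrite addn1 (sum_monotone_bool mono).
- move=> i j a b i1 ij jm si sj.
  have := sigma_star_after (leq_trans ij jm) si.
  by move=> /(sigma_star_monotone ij jm); rewrite sj.
Qed.

(** The rule is greedy: labels above [left] were exercised before k, and labels below [left] must
    wait until strictly after the right [left], so only that right can be exercised at k. *)
Lemma used_sigma_star m (k : 'I_N.+1) w :
  let left := (m - \sum_(j < k) used m (sigma m) j w)%N in
  used m (sigma m) k w =
    (0 < left)%N && (xstar r lam left (N - k) <= ratio k w) :> nat.
Proof.
move=> left.
have lt_left i : (1 <= i <= m)%N -> date_lt (sigma m i w) k = (left < i)%N.
  rewrite /left sum_used; apply: (@sum_monotone_bool m
    (fun i => date_lt (sigma m i w) k)) => {}i j _ ij jm.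
  exact: sigma_star_monotone.
have at_left i : (1 <= i <= m)%N -> i != left ->
    date_at (sigma m i w) k = false.
  move=> im il; case E : (date_at _ _) => //.
  move: (E); rewrite date_atE lt_left // -leqNgt => /andP[_ il'].
  have {il il'} il : (i < left)%N by rewrite ltn_neqAle il.
  have lm : (left <= m)%N by rewrite leq_subr.
  move: E; rewrite date_at_some => /eqP /(sigma_star_after (leq_trans il lm)).
  by rewrite lt_left ?(leq_trans il lm) // ltnS leqNgt il.
have [l0|l0] := posnP left.
  rewrite /used big_nat_cond big1 // => i; rewrite andbT ltnS => im.
  by rewrite at_left // l0; move: im; case: (i).
have lm : (1 <= left <= m)%N by rewrite l0 leq_subr.
have lnot : ~~ date_lt (sigma m left w) k by rewrite lt_left // ltnn.
rewrite /used (bigD1_seq left) ?iota_uniq ?mem_index_iota ?ltnS //=.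
rewrite big_nat_cond big1 ?addn0 => [|i]; last first.
  by rewrite ltnS => /andP[im il]; rewrite at_left.
congr nat_of_bool; rewrite date_at_some.
(* The top right has no predecessor to wait for; otherwise the right [left.+1] has been exercised
   before k. *)
have [lem|lem] := eqVneq left m.
  by move: lnot; rewrite lem sigma_star_top first_dateE => ->; rewrite andbT.
have lm' : (left < m)%N by rewrite ltn_neqAle lem; case/andP: lm.
move: lnot; rewrite sigma_star_rec // first_dateE => ->.
by rewrite andbT lt_left ?ltnS ?lm' // leqnn.
Qed.

End Thresholds.

(** * Expectations as means over sign patterns *)

Section Expectation.
Context {R : realType} {d : measure_display} {T : measurableType d}.
Context {P : probability T R} (r lam s0 m0 : R) {N : nat}.
Context (eps : 'I_N -> {RV P >-> R}).
Hypothesis eps_iid : iid_steps r lam eps.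

Local Notation coins := {ffun 'I_N -> bool}.
Local Notation p := (pup r lam).
Local Notation q := (qdown r lam).

Let pq1 : p + q = 1.
Proof. by rewrite /qdown addrC subrK. Qed.

Lemma path_eventE b : path_event eps b =
  \bigcap_(i in [set` [set: 'I_N]%SET]) (eps i @^-1` [set step (b i) : R]).
Proof.
apply/seteqP; split => w /= h i; first by move=> _; exact: h.
by apply: h; rewrite /= inE.
Qed.

Lemma measurable_path_event b : measurable (path_event eps b).
Proof.
by rewrite path_eventE; apply: fin_bigcap_measurable.
Qed.

Lemma probability_path_event b : P (path_event eps b) = (weight p q b)%:E.
Proof.
case: eps_iid => indep up down; rewrite path_eventE.
rewrite (indep _ (fun i => [set step (b i)])) => [|i]; last first.
  exact: measurable_set1.
rewrite /weight -prodEFin; apply: eq_big => i; first by rewrite inE.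
by move=> _; rewrite /step /toss; case: (b i); [exact: up|exact: down].
Qed.

Lemma trivIset_path_event : trivIset setT (path_event eps).
Proof.
move=> b b' _ _ [w [bw bw']]; apply/ffunP => i.
have := bw i; rewrite bw' /step; case: (b i); case: (b' i) => //.
  by move=> h; exfalso; lra.
by move=> h; exfalso; lra.
Qed.

Let paths := \big[setU/set0]_(b <- index_enum coins) path_event eps b.

Let measurable_paths : measurable paths.
Proof. by apply: bigsetU_measurable => b _; exact: measurable_path_event. Qed.

(** The integrand is constant on each of the finitely many disjoint path events. *)
Let integral_paths (X : T -> R) (H : coins -> R) :
  measurable_fun setT X -> (forall w, 0 <= X w) ->
  (forall b w, path_event eps b w -> X w = H b) ->
  (\int[P]_(w in paths) (X w)%:E = (mean p q H)%:E)%E.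
Proof.
move=> mX X0 XH; rewrite ge0_integral_bigsetU; first last.
- by move=> w _; rewrite lee_fin.
- by apply/measurable_EFinP; exact: measurable_funTS.
- exact: sub_trivIset trivIset_path_event.
- exact: index_enum_uniq.
- exact: measurable_path_event.
rewrite /mean -sumEFin; apply: eq_bigr => b _.
rewrite (eq_integral (fun=> (H b)%:E)); last by move=> w; rewrite inE => /XH ->.
rewrite integral_cst; last exact: measurable_path_event.
by rewrite mulrC EFinM; congr (_ * _)%E; exact: probability_path_event.
Qed.

(* The 2^N events prescribing all steps carry the whole probability, so the
   possible other values of eps are negligible. *)
Lemma expectation_mean (X : T -> R) (H : coins -> R) :
  measurable_fun setT X -> (forall w, 0 <= X w) ->
  (forall b w, path_event eps b w -> X w = H b) ->
  ('E_P[X] = (mean p q H)%:E)%E.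
Proof.
move=> mX X0 XH; rewrite -(integral_paths mX X0 XH) unlock.
(* The constant 1 is itself an instance of [integral_paths], and its mean is 1. *)
have P1 : (P paths = 1)%E.
  rewrite -[LHS]mul1e -(integral_cst P) //.
  by rewrite (@integral_paths (fun=> 1) (fun=> 1)) // mean_cst.
rewrite (@ge0_negligible_integral _ _ _ _ _ (~` paths)) //.
- by rewrite setDE setTI setCK.
- exact: measurableC.
- exact/measurable_EFinP.
- by move=> w _; rewrite lee_fin.
- by rewrite [LHS]probability_setC // P1 subee.
Qed.

(** Every pattern has positive probability, hence an outcome; choosing one turns random quantities
    into functions of the pattern. *)
Lemma path_event_inhabited : 0 < p -> 0 < q ->
  exists rep : coins -> T, forall b, path_event eps b (rep b).
Proof.
move=> p0 q0.
suff /choice[rep repP] : forall b, exists w, path_event eps b w by exists rep.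
move=> b; apply: contrapT => /forallNP h.
have : (P (path_event eps b) = 0)%E.
  rewrite (_ : path_event eps b = set0) ?measure0 //.
  by apply/seteqP; split => w // /h.
rewrite probability_path_event => -[] /eqP.
rewrite gt_eqF // /weight; apply: prodr_gt0 => i _.
by rewrite /toss; case: (b i).
Qed.

End Expectation.

(** * Supermartingale verification for an abstract exercise rule *)

Section Verification.
Context {R : realType} {d : measure_display} {T : measurableType d}.
Context {P : probability T R} (r lam s0 m0 : R) {N : nat}.
Context (eps : 'I_N -> {RV P >-> R}).
Hypotheses (r_gt0 : 0 < r) (lam_gt1 : 1 < lam).
Hypotheses (no_arb_lo : lam^-1 < 1 + r) (no_arb_hi : 1 + r < lam).
Hypotheses (s0_gt0 : 0 < s0) (m0_ge : s0 <= m0).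

Local Notation price := (Defs.price lam s0 eps).
Local Notation runmax := (Defs.runmax lam s0 m0 eps).
Local Notation ratio := (Defs.ratio lam s0 m0 eps).
Local Notation coins := {ffun 'I_N -> bool}.
Local Notation p := (pup r lam).
Local Notation q := (qdown r lam).
Local Notation V := (Defs.V r lam).

Let lam_gt0 : 0 < lam.
Proof. exact: lt_trans lam_gt1. Qed.

Let pq1 : p + q = 1.
Proof. by rewrite /qdown addrC subrK. Qed.

Let p_ge0 : 0 <= p.
Proof. exact/ltW/pup_gt0. Qed.

Let q_ge0 : 0 <= q.
Proof. exact/ltW/qdown_gt0. Qed.

(** The rule enters through the number [u] of rights spent per date: at most one a day, at most [m]
    in total, and adapted in the sense of [u_agree]. *)
Variables (rep : coins -> T) (repP : forall b, path_event eps b (rep b)).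
Variables (m : nat) (u : nat -> T -> nat).
Hypothesis u_le1 : forall k w, (u k w <= 1)%N.
Hypothesis u_le : forall w k, (\sum_(j < k) u j w <= m)%N.
Hypothesis u_agree : forall k b b', (k <= N)%N -> agree_below k b b' ->
  u k (rep b) = u k (rep b').

Definition left_rights (k : nat) (w : T) : nat := (m - \sum_(j < k) u j w)%N.

Definition cash (k : nat) (w : T) : R :=
  \sum_(j < k) (u j w)%:R * (alpha r ^+ j * runmax j w).

(* Discounted cash received before date k plus the discounted value of the
   remaining rights: a supermartingale, and a martingale for the greedy rule. *)
Definition gain (k : nat) (w : T) : R :=
  cash k w +
  alpha r ^+ k * (price k w * V (left_rights k w) (N - k) (ratio k w)).

Lemma left_rightsS k w : left_rights k.+1 w = (left_rights k w - u k w)%N.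
Proof. by rewrite /left_rights big_ord_recr /= subnDA. Qed.

Lemma used_le_left k w : (u k w <= left_rights k w)%N.
Proof.
have := u_le w k.+1; rewrite /left_rights big_ord_recr /= => h.
by rewrite leq_subRL // (leq_trans (leq_addr _ _) h).
Qed.

Lemma left_rights_agree k b b' : (k <= N)%N -> agree_below k b b' ->
  left_rights k (rep b) = left_rights k (rep b').
Proof.
move=> kN bb'; congr (_ - _)%N; apply: eq_bigr => j _.
have jk := ltnW (ltn_ord j).
by apply: u_agree; [exact: leq_trans kN|exact: agree_below_le bb'].
Qed.

Lemma cash_agree k b b' : (k <= N)%N -> agree_below k b b' ->
  cash k (rep b) = cash k (rep b').
Proof.
move=> kN bb'; apply: eq_bigr => j _; have jk := ltnW (ltn_ord j).
have jbb' := agree_below_le jk bb'.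
rewrite (u_agree (leq_trans jk kN) jbb').
by rewrite (runmax_agree _ _ _ jbb' (repP b) (repP b')).
Qed.

Lemma agree_update (k : 'I_N) (b : coins) v : agree_below k (update b k v) b.
Proof.
by move=> i ik; rewrite ffunE; case: eqP ik => // ->; rewrite ltnn.
Qed.

(** One-step conditional mean of [gain]: the discount and the price factor of each step merge with p
    and q into the tilted weights, which is why [calB] appears. *)
Lemma gain_average (k : 'I_N) b : let w := rep b in
  p * gain k.+1 (rep (update b k true)) +
  q * gain k.+1 (rep (update b k false)) =
  cash k w + alpha r ^+ k * (price k w * ((u k w)%:R * ratio k w +
    calB r lam (V (left_rights k w - u k w) (N - k.+1)) (ratio k w))).
Proof.
move=> w; have kN := ltnW (ltn_ord k).
have eps_k v : eps k (rep (update b k v)) = step v.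
  by rewrite repP ffunE eqxx.
(* Whatever is decided by date k ignores coin k; only the new price factor and the new ratio depend
   on v. *)
have E v : gain k.+1 (rep (update b k v)) = cash k w +
    (u k w)%:R * (alpha r ^+ k * runmax k w) + alpha r ^+ k.+1 *
    (price k w * lam `^ step v * V (left_rights k w - u k w) (N - k.+1)
       (ratio k.+1 (rep (update b k v)))).
  have a := @agree_update k b v.
  rewrite /gain priceS // eps_k left_rightsS (left_rights_agree kN a).
  rewrite (u_agree kN a) (price_agree _ _ a (repP _) (repP b)).
  rewrite /cash big_ord_recr /= -/(cash k _) (cash_agree kN a) (u_agree kN a).
  by rewrite (runmax_agree _ _ _ a (repP _) (repP b)).
have ratio_k v : ratio k (rep (update b k v)) = ratio k w.
  exact: ratio_agree (@agree_update k b v) (repP _) (repP b).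
rewrite !E (ratio_up m0 lam_gt0 s0_gt0) // (ratio_down m0 lam_gt0 s0_gt0) //.
rewrite !ratio_k runmaxE // /step powRr1 ?ltW // powR_inv1 ?ltW //.
rewrite /calB /ptilde /qtilde exprS.
have -> : q = 1 - p by have := pq1; lra.
by ring.
Qed.

Lemma mean_gain_le (k : 'I_N) :
  mean p q (gain k.+1 \o rep) <= mean p q (gain k \o rep).
Proof.
rewrite (mean_tower pq1 k); apply: mean_le => // b /=.
rewrite gain_average /gain lerD2l; have kN : (N - k = (N - k.+1).+1)%N.
  by rewrite subnSK.
rewrite ler_pM2l ?exprn_gt0 ?alpha_gt0 // ler_pM2l ?price_gt0 // kN.
have := used_le_left k (rep b); have := u_le1 k (rep b).
case: (u k (rep b)) => [|[|//]] _ h.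
  exact: (@V_exercise_le _ _ _ _ _ _ false).
exact: (@V_exercise_le _ _ _ _ _ _ true).
Qed.

Lemma mean_gain_eq (k : 'I_N) :
  (forall w, u k w = (0 < left_rights k w)%N &&
     (xstar r lam (left_rights k w) (N - k) <= ratio k w) :> nat) ->
  mean p q (gain k.+1 \o rep) = mean p q (gain k \o rep).
Proof.
move=> greedy; rewrite (mean_tower pq1 k); apply: eq_bigr => b _ /=.
rewrite gain_average /gain greedy; have -> : (N - k = (N - k.+1).+1)%N.
  by rewrite subnSK.
by rewrite V_exercise_eq // ratio_ge1.
Qed.

(** At date N no coin is left: [V] with n = 0 is the value of a single exercise if a right remains,
    and at most one right can be spent. *)
Lemma cash_le_gain w : cash N.+1 w <= gain N w.
Proof.
rewrite /cash big_ord_recr /= lerD2l // subnn mulrCA.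
rewrite ler_pM2l ?exprn_gt0 ?alpha_gt0 // runmaxE // mulrCA.
rewrite ler_pM2l ?price_gt0 //.
have := used_le_left N w; have := u_le1 N w.
have x1 := ratio_ge1 m0 eps lam_gt0 s0_gt0 N w.
case: (u N w) => [|[|//]] _; case: (left_rights N w) => [|n] //= _;
  by rewrite /g ?mul1r ?mul0r // (le_trans ler01).
Qed.

Lemma cash_eq_gain w :
  (u N w = (0 < left_rights N w)%N &&
     (xstar r lam (left_rights N w) 0 <= ratio N w) :> nat) ->
  cash N.+1 w = gain N w.
Proof.
move=> greedy; rewrite /gain /cash big_ord_recr /= subnn; congr (_ + _).
rewrite mulrCA runmaxE // (mulrCA _ (price N w)) greedy.
case: (left_rights N w) => [|n] /=; first by rewrite mul0r.
(* The threshold at n = 0 is 1, so a remaining right is always exercised at date N. *)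
by rewrite xstar0 // ratio_ge1 // mul1r.
Qed.

Lemma mean_gain0 : mean p q (gain 0 \o rep) = s0 * V m N (m0 / s0).
Proof.
rewrite -[RHS](@mean_cst _ p q N pq1); apply: eq_bigr => b _ /=.
rewrite /gain /cash /left_rights !big_ord0 add0r expr0 mul1r !subn0.
by rewrite /Defs.ratio runmax0 // price0.
Qed.

Lemma mean_cash_le : mean p q (cash N.+1 \o rep) <= s0 * V m N (m0 / s0).
Proof.
suff h k : (k <= N)%N -> mean p q (gain k \o rep) <= s0 * V m N (m0 / s0).
  apply: le_trans (h N (leqnn N)); apply: mean_le => // b.
  exact: cash_le_gain.
elim: k => [_|k IH kN]; first by rewrite mean_gain0.
exact: le_trans (mean_gain_le (Ordinal kN)) (IH (ltnW kN)).
Qed.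

Lemma mean_cash_eq :
  (forall k w, (k <= N)%N -> u k w = (0 < left_rights k w)%N &&
     (xstar r lam (left_rights k w) (N - k) <= ratio k w) :> nat) ->
  mean p q (cash N.+1 \o rep) = s0 * V m N (m0 / s0).
Proof.
move=> greedy.
have h k : (k <= N)%N -> mean p q (gain k \o rep) = s0 * V m N (m0 / s0).
  elim: k => [_|k IH kN]; first by rewrite mean_gain0.
  rewrite (@mean_gain_eq (Ordinal kN)) ?IH ?(ltnW kN) // => w.
  by apply: greedy; exact: ltnW.
rewrite -(h N (leqnn N)); apply: eq_bigr => b _ /=.
by rewrite cash_eq_gain // greedy // subnn.
Qed.

End Verification.

(** * Expected payoff of admissible exercise vectors *)

Section Admissible.
Context {R : realType} {d : measure_display} {T : measurableType d}.
Context {P : probability T R} (r lam s0 m0 : R) {N : nat}.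
Context (eps : 'I_N -> {RV P >-> R}).
Hypotheses (r_gt0 : 0 < r) (lam_gt1 : 1 < lam).
Hypotheses (no_arb_lo : lam^-1 < 1 + r) (no_arb_hi : 1 + r < lam).
Hypotheses (s0_gt0 : 0 < s0) (m0_ge : s0 <= m0).
Hypothesis eps_iid : iid_steps r lam eps.

Local Notation payoff := (Defs.payoff r lam s0 m0 eps).
Local Notation runmax := (Defs.runmax lam s0 m0 eps).
Local Notation coins := {ffun 'I_N -> bool}.
Local Notation V := (Defs.V r lam).

Let lam_gt0 : 0 < lam.
Proof. exact: lt_trans lam_gt1. Qed.

(** The events that tau is at most j lie in the filtration at j, hence depend on the price history
    only; being at k is a difference of two consecutive ones. *)
Lemma date_at_agree (tau : T -> @date N) k (b b' : coins) w w' : (k <= N)%N ->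
  stopping_time lam s0 eps tau -> agree_below k b b' ->
  path_event eps b w -> path_event eps b' w' ->
  date_at (tau w) k = date_at (tau w') k.
Proof.
move=> kN st bb' bw bw'.
have le_agree j : (j <= k)%N -> date_le (tau w) j = date_le (tau w') j.
  move=> jk; have jN : (j < N.+1)%N by exact: leq_trans kN.
  have eq_price i : (i <= j)%N ->
      Defs.price lam s0 eps i w = Defs.price lam s0 eps i w'.
    move=> ij; apply: price_agree bw bw'.
    by apply: agree_below_le bb'; exact: leq_trans jk.
  apply/idP/idP => h.
    exact: (@filtration_saturated _ _ _ _ _ _ _ _ _ _ w w' (st (Ordinal jN))).
  apply: (@filtration_saturated _ _ _ _ _ _ _ _ _ _ w' w
    (st (Ordinal jN))) => //; by move=> i ij; rewrite eq_price.
rewrite !date_atE le_agree //; case: k {kN bb'} le_agree => [|k] h.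
  by rewrite !date_lt0.
by rewrite !date_lt_le h.
Qed.

Lemma measurable_date_at (tau : T -> @date N) (k : 'I_N.+1) :
  stopping_time lam s0 eps tau -> measurable [set w | date_at (tau w) k].
Proof.
move=> st.
have le_meas (j : 'I_N.+1) : measurable [set w | date_le (tau w) j].
  by apply: filtration_measurable; exact: st.
have -> : [set w | date_at (tau w) k] =
    [set w | date_le (tau w) k] `\` [set w | date_lt (tau w) k].
  apply/seteqP; split => w /=; first by rewrite date_atE => /andP[? /negP].
  by rewrite date_atE => -[-> /negP].
apply: measurableD => //; case: k => -[|k] kN /=.
  by rewrite (_ : [set w | _] = set0) //; apply/seteqP; split => w //=;
    rewrite date_lt0.
rewrite (_ : [set w | _] = [set w | date_le (tau w) k]); last first.
  by apply/seteqP; split => w /=; rewrite date_lt_le.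
exact: (le_meas (Ordinal (ltnW kN))).
Qed.

Variables (m : nat) (sigma : nat -> T -> @date N).
Hypothesis sigma_adm : admissible lam s0 eps m sigma.

Lemma used_le1 k w : (used m sigma k w <= 1)%N.
Proof.
apply: (@sum_exclusive_bool m (fun i => date_at (sigma i w) k)) => i j i1 ij jm.
have [_ /(_ w)[l _ [_ strict]]] := sigma_adm.
case Ei : (sigma i w) => [a|//] /= /eqP ak.
case Ej : (sigma j w) => [b|//] /= /eqP bk.
by have := strict _ _ _ _ i1 ij jm Ei Ej; rewrite ak bk ltnn.
Qed.

Lemma used_agree k (b b' : coins) w w' : (k <= N)%N -> agree_below k b b' ->
  path_event eps b w -> path_event eps b' w' ->
  used m sigma k w = used m sigma k w'.
Proof.
move=> kN bb' bw bw'; rewrite /used !big_add1 !big_mkord.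
apply: eq_bigr => i _; congr nat_of_bool.
apply: (date_at_agree kN _ bb' bw bw').
by apply: sigma_adm.1; rewrite ltn_ord.
Qed.

Lemma payoff_ge0 w : 0 <= payoff m sigma w.
Proof.
apply: sumr_ge0 => i _; case: (sigma i w) => // k.
by rewrite mulr_ge0 ?exprn_ge0 ?ltW ?alpha_gt0 ?runmax_gt0.
Qed.

Lemma measurable_payoff : measurable_fun setT (payoff m sigma).
Proof.
rewrite (funext (payoff_used r lam s0 m0 eps m sigma)).
apply: measurable_sum => k; apply: measurable_funM; last first.
  by apply: measurable_funM => //; exact: measurable_runmax.
(* The count of exercised rights is a sum of indicators of measurable events. *)
rewrite (_ : (fun w => _) = fun w => \sum_(i < m)
    \1_[set w | date_at (sigma i.+1 w) k] w); last first.
  apply/funext => w; rewrite /used natr_sum big_add1 big_mkord.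
  by apply: eq_bigr => i _; rewrite indicE; congr (_%:R); rewrite mem_setE.
apply: measurable_sum => i; apply: measurable_indic.
by apply: measurable_date_at; apply: sigma_adm.1; rewrite ltn_ord.
Qed.

Lemma expectation_payoff (rep : coins -> T) :
  (forall b, path_event eps b (rep b)) ->
  ('E_P[payoff m sigma] =
   (mean (pup r lam) (qdown r lam)
      (cash r lam s0 m0 eps (used m sigma) N.+1 \o rep))%:E)%E.
Proof.
move=> repP; apply: (expectation_mean eps_iid).
- exact: measurable_payoff.
- exact: payoff_ge0.
- move=> b w bw /=; rewrite payoff_used; apply: eq_bigr => k _.
  (* Here the agreement lemmas compare two outcomes of one and the same pattern. *)
  have bb : agree_below k b b by [].
  rewrite (used_agree _ bb bw (repP b)); last by rewrite -ltnS.
  by rewrite (runmax_agree _ _ _ bb bw (repP b)).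
Qed.

Lemma expectation_payoff_le :
  ('E_P[payoff m sigma] <= (s0 * V m N (m0 / s0))%:E)%E.
Proof.
have [rep repP] := path_event_inhabited eps_iid
  (pup_gt0 no_arb_lo no_arb_hi) (qdown_gt0 no_arb_lo no_arb_hi).
rewrite (expectation_payoff repP) lee_fin.
apply: mean_cash_le => //; first exact: used_le1.
  by move=> w k; exact: sum_used_le.
by move=> k b b' kN bb'; exact: used_agree bb' (repP b) (repP b').
Qed.

Lemma expectation_payoff_greedy :
  (forall (k : 'I_N.+1) w,
     let left := (m - \sum_(j < k) used m sigma j w)%N in
     used m sigma k w = (0 < left)%N && (xstar r lam left (N - k) <=
       Defs.ratio lam s0 m0 eps k w) :> nat) ->
  ('E_P[payoff m sigma] = (s0 * V m N (m0 / s0))%:E)%E.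
Proof.
move=> greedy.
have [rep repP] := path_event_inhabited eps_iid
  (pup_gt0 no_arb_lo no_arb_hi) (qdown_gt0 no_arb_lo no_arb_hi).
rewrite (expectation_payoff repP); congr EFin.
apply: mean_cash_eq => //.
  by move=> k b b' kN bb'; exact: used_agree bb' (repP b) (repP b').
by move=> k w kN; exact: (greedy (Ordinal (kN : (k < N.+1)%N))).
Qed.

End Admissible.

Theorem theorem5p4 (R : realType) (d : measure_display)
    (T : measurableType d) (P : probability T R)
    (r lam s0 m0 : R) (N : nat) (eps : 'I_N -> {RV P >-> R})
    (r_gt0 : 0 < r) (lam_gt1 : 1 < lam)
    (no_arb_lo : lam^-1 < 1 + r) (no_arb_hi : 1 + r < lam)
    (s0_gt0 : 0 < s0) (m0_ge : s0 <= m0)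
    (eps_iid : iid_steps r lam eps) :
  (* (i) *)
  (forall m n, (1 <= m)%N ->
     [/\ forall x y, 1 <= x -> x < y ->
           x - f r lam m n x < y - f r lam m n y,
         0 < 1 - alpha r /\
         (forall x y, 1 <= x -> x < y ->
           1 - alpha r <=
             ((y - f r lam m n y) - (x - f r lam m n x)) / (y - x)),
         x - f r lam m n x @[x --> +oo] --> +oo,
         has_inf (D r lam m n) /\ 1 <= xstar r lam m n &
         D r lam m n = `[xstar r lam m n, +oo[%classic]) /\
  (* (ii) *)
  (forall m, (1 <= m)%N ->
     xstar r lam m 0 = 1 /\
     forall n, (n < N)%N -> xstar r lam m n <= xstar r lam m n.+1) /\
  (* (iii) *)
  (forall m n, (1 <= m)%N ->
     xstar r lam m.+1 n <= xstar r lam m n /\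
     D r lam m n `<=` D r lam m.+1 n) /\
  (* (iv) *)
  (forall m, (1 <= m)%N ->
     let sigma := sigma_star r lam s0 m0 eps m in
     let value :=
       ereal_sup [set 'E_P[payoff r lam s0 m0 eps m tau]
                 | tau in admissible lam s0 eps m]%E in
     [/\ admissible lam s0 eps m sigma,
         'E_P[payoff r lam s0 m0 eps m sigma]%E = value &
         value = (s0 * V r lam m N (m0 / s0))%:E]).
Proof.
split; last split; last split.
- case=> [//|m] n _; split.
  + exact: f_increasing.
  + by split; [rewrite subr_gt0; exact: alpha_lt1|exact: f_secant_slope].
  + exact: f_gap_cvg.
  + by split; [exact: D_has_inf|exact: xstar_ge1].
  + exact: D_interval.
- by case=> [//|m] _; split=> [|n _]; [exact: xstar0|exact: xstar_homo].
- by case=> [//|m] n _; split; [exact: xstar_antitone|exact: D_sub].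
- move=> m _ sigma value.
  have lam_gt0 : 0 < lam by exact: lt_trans lam_gt1.
  have sigma_adm : admissible lam s0 eps m sigma.
    exact: sigma_star_admissible.
  have E : ('E_P[payoff r lam s0 m0 eps m sigma] =
            (s0 * V r lam m N (m0 / s0))%:E)%E.
    by apply: expectation_payoff_greedy => // k w; exact: used_sigma_star.
  have valueE : value = (s0 * V r lam m N (m0 / s0))%:E.
    apply/le_anti/andP; split.
      by apply: ge_ereal_sup => _ [tau adm <-]; exact: expectation_payoff_le.
    (* The threshold rule is admissible and its payoff has mean equal to the upper bound. *)
    by apply: ereal_sup_ubound; exists sigma.
  by split; rewrite ?E ?valueE.
Qed.
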